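(* Let $\mathbb{X}$ be a two-dimensional real polygonal Banach space. Then $\mathbb{X}$ is a Radon plane if and only if $\mathbb{X}$ satisfies the translated edge property (TEP).
   Context: For a two-dimensional real Banach space $(\mathbb{X}, \|\cdot\|)$, $B_{\mathbb{X}} = \{x : \|x\| \le 1\}$ and $S_{\mathbb{X}} = \{x : \|x\| = 1\}$; $\overline{uv} = \{(1-t)u + tv : t \in [0,1]\}$. Birkhoff-James orthogonality: $x \perp_B y$ means $\|x + \lambda y\| \ge \|x\|$ for all $\lambda \in \mathbb{R}$. $\mathbb{X}$ is a Radon plane if $\perp_B$ is symmetric, i.e. $x \perp_B y$ implies $y \perp_B x$ for all $x, y \in \mathbb{X}$. $\mathbb{X}$ is polygonal if $B_{\mathbb{X}}$ has only finitely many extreme points, equivalently $S_{\mathbb{X}}$ is a polygon; the vertices of $S_{\mathbb{X}}$ are the extreme points of $B_{\mathbb{X}}$, and the edges are the closed segments in $S_{\mathbb{X}}$ joining consecutive vertices. Two distinct edges are adjacent if they share a vertex. Extreme supporting functional: for an edge $L$ of $S_{\mathbb{X}}$, it is the unique linear functional $f$ on $\mathbb{X}$ with $\|f\| = 1$ and $f(x) = 1$ for all $x \in L$. Translated vertex property (TVP): an edge $L$ of $S_{\mathbb{X}}$ satisfies TVP if the kernel of the extreme supporting functional corresponding to $L$ (the line through the origin parallel to $L$) contains a pair of vertices $\pm v$ of $S_{\mathbb{X}}$. In that case $\pm v$ are called the translated vertices corresponding to $L$. Translated edge property (TEP): two adjacent edges $L, M$ of $S_{\mathbb{X}}$ with common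 vertex $x$ satisfy TEP if (i) both $L$ and $M$ satisfy TVP, with translated vertices $\pm v$ and $\pm w$ respectively; and (ii) either $\overline{vw}$ or $\overline{v(-w)}$ is an edge of $S_{\mathbb{X}}$ which satisfies TVP with translated vertices $\pm x$. The space $\mathbb{X}$ satisfies TEP if every pair of adjacent edges of $S_{\mathbb{X}}$ satisfies TEP. *)

(* Defs.v *)
From mathcomp Require Import all_boot all_order all_algebra.
From mathcomp Require Import all_classical all_reals all_analysis.

Set Implicit Arguments.
Unset Strict Implicit.
Unset Printing Implicit Defensive.

Import Order.TTheory GRing.Theory Num.Theory.
Import numFieldNormedType.Exports.

Local Open Scope classical_set_scope.
Local Open Scope ring_scope.

(* [V] need not carry a [vectType] structure: we only ask that a linear
   isomorphism with R^2 exists. *)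
Definition two_dimensional (R : realType) (V : normedModType R) : Prop :=
  inhabited (Vector.axiom 2 V).

Definition unit_ball (R : realType) (V : normedModType R) : set V :=
  [set x | `|x| <= 1].

Definition unit_sphere (R : realType) (V : normedModType R) : set V :=
  [set x | `|x| = 1].

Definition segment (R : realType) (V : normedModType R) (u v : V) : set V :=
  [set (1 - t) *: u + t *: v | t in `[0, 1]].

Definition extreme_point (R : realType) (V : normedModType R)
    (K : set V) (x : V) : Prop :=
  K x /\ forall (y z : V) (t : R), K y -> K z -> 0 < t < 1 ->
    x = (1 - t) *: y + t *: z -> y = x /\ z = x.

Definition BJ_orthogonal (R : realType) (V : normedModType R)
    (x y : V) : Prop :=
  forall lambda : R, `|x + lambda *: y| >= `|x|.

Definition radon_plane (R : realType) (V : normedModType R) : Prop :=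
  forall x y : V, BJ_orthogonal x y -> BJ_orthogonal y x.

Definition is_vertex (R : realType) (V : normedModType R) (x : V) : Prop :=
  extreme_point (@unit_ball R V) x.

Definition polygonal (R : realType) (V : normedModType R) : Prop :=
  finite_set [set x : V | is_vertex x].

(* The last clause says that [u] and [v] are consecutive vertices. *)
Definition is_edge (R : realType) (V : normedModType R) (L : set V) : Prop :=
  exists u v : V,
    [/\ is_vertex u /\ is_vertex v, u <> v, L = segment u v,
        L `<=` @unit_sphere R V &
        forall w : V, is_vertex w -> L w -> w = u \/ w = v].

(* The supremum is the operator norm only when the functional is bounded,
   which is automatic in finite dimension. *)
Definition functional_norm (R : realType) (V : normedModType R)
    (f : {scalar V}) : R :=
  sup [set `|f x| | x in @unit_ball R V].

Definition extreme_supporting_functional (R : realType) (V : normedModType R)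
    (L : set V) (f : {scalar V}) : Prop :=
  functional_norm f = 1 /\ forall x : V, L x -> f x = 1.

(* The pair is represented by one of its members: if [v] is a vertex in the
   kernel, then so is [- v]. For an edge [L] of a two-dimensional space the
   functional [f] is unique, and [v] is determined up to sign. *)
Definition translated_vertex (R : realType) (V : normedModType R)
    (L : set V) (v : V) : Prop :=
  is_vertex v /\
  exists f : {scalar V}, extreme_supporting_functional L f /\ f v = 0.

Definition adjacent_at (R : realType) (V : normedModType R)
    (L M : set V) (x : V) : Prop :=
  [/\ is_edge L, is_edge M, L <> M, is_vertex x & L x /\ M x].

Definition TEP_pair (R : realType) (V : normedModType R)
    (L M : set V) (x : V) : Prop :=
  exists v w : V,
    [/\ translated_vertex L v,
        translated_vertex M w &
        (is_edge (segment v w) /\ translated_vertex (segment v w) x) \/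
        (is_edge (segment v (- w)) /\ translated_vertex (segment v (- w)) x)].

Definition satisfies_TEP (R : realType) (V : normedModType R) : Prop :=
  forall (L M : set V) (x : V), adjacent_at L M x -> TEP_pair L M x.

(* Main.v *)
(* Write [x _|_ y] as: some functional of norm 1 attains its norm at [x] and
   vanishes at [y].

   Radon => TEP. If [a x] is an edge, then [a] and [x] are orthogonal to the unit
   vector [v] along [a - x], hence [v _|_ a] and [v _|_ x]: two supporting lines
   at [v], so [v] is a vertex. If [b x] is the adjacent edge with vertex [w],
   the supporting functional [k] of [v] with kernel through [x] takes the value 1
   or -1 at [w], since [x] determines it up to scaling; so [v] and [w] (or [-w])
   span an edge parallel to [x].

   TEP => Radon. Let [x _|_ y] with supporting functional [f], and rotate the line
   [f = 1] about [x] both ways until it hits vertices [a] and [b] on either side.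
   If neither rotation moves it, [x] lies inside the edge [a b] and [y] is
   parallel to it; TEP at both ends gives [y _|_ a] and [y _|_ b], and [y _|_ z]
   is preserved along the segment. Otherwise [x] is a vertex with edges [a x]
   and [x b]; TEP provides an edge [v w] parallel to [x], and [y] is a multiple
   of a point of [v w], with the rotation amounts as weights. *)

From HB Require Import structures.
Require Import Defs.
From mathcomp Require Import all_boot all_order all_algebra.
From mathcomp Require Import all_classical all_reals all_analysis.
From mathcomp Require Import ring lra.

Set Implicit Arguments.
Unset Strict Implicit.
Unset Printing Implicit Defensive.

Import Order.TTheory GRing.Theory Num.Theory.
Import numFieldNormedType.Exports.

Local Open Scope classical_set_scope.
Local Open Scope ring_scope.

(** * Linear functionals and orthogonality in a normed space *)

Section Functionals.
Context (R : realType) (V : normedModType R).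
Implicit Types (f g h : {scalar V}) (x y z u v : V).

Lemma scalarD_eq f u v : f (u + v) = f u + f v.
Proof. exact: linearD. Qed.

Lemma scalarN_eq f u : f (- u) = - f u.
Proof. exact: linearN. Qed.

Lemma scalarZ_eq f a u : f (a *: u) = a * f u.
Proof. exact: linearZ. Qed.

Lemma scalar0_eq f : f 0 = 0.
Proof. exact: linear0. Qed.

Definition scalE f :=
  (scalarD_eq f, scalarN_eq f, scalarZ_eq f, scalar0_eq f).
Arguments scalE : clear implicits.

Lemma scalar_ex (k : V -> R) : scalar k -> exists h : {scalar V}, h =1 k.
Proof.
move=> k_lin.
pose h : {scalar V} := HB.pack k (GRing.isLinear.Build _ _ _ _ k k_lin).
by exists h.
Qed.

Lemma scalar_comb f g a b :
  exists h : {scalar V}, forall z, h z = a * f z + b * g z.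
Proof. by apply: scalar_ex => c u v; rewrite !scalE; ring. Qed.

(** Dual norm at most 1, stated pointwise so that no supremum has to be handled. *)
Definition contraction f := forall z, `|f z| <= `|z|.

Lemma contraction_unit_ball f :
  (forall z, `|z| <= 1 -> f z <= 1) -> contraction f.
Proof.
move=> f_le1 z; have [->|z_neq0] := eqVneq z 0; first by rewrite scalE !normr0.
have nz : 0 < `|z| by rewrite normr_gt0.
have pos u : `|u| = `|z| -> f u <= `|z|.
  move=> uz; have := f_le1 (`|z|^-1 *: u).
  rewrite normrZ normfV normr_id uz mulVf ?gt_eqF // scalE => /(_ (lexx _)).
  by rewrite mulrC ler_pdivrMr // mul1r.
rewrite ler_norml pos // andbT lerNl -scalarN_eq.
by apply: pos; rewrite normrN.
Qed.

Lemma functional_norm_eq1 f x :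
  contraction f -> `|x| <= 1 -> f x = 1 -> functional_norm f = 1.
Proof.
move=> fC x1 fx; apply/eqP; rewrite eq_le; apply/andP; split.
  apply: ge_sup; first by exists `|f x|, x.
  by move=> _ [z z1 <-]; exact: le_trans (fC z) z1.
apply: ub_le_sup; last by exists x => //; rewrite fx normr1.
by exists 1 => _ [z z1 <-]; exact: le_trans (fC z) z1.
Qed.

(** A [sup] that does not exist has the default value 0, so the value 1 already forces [f] to be
    bounded on the ball. *)
Lemma functional_norm1_contraction f : functional_norm f = 1 -> contraction f.
Proof.
move=> f1; apply: contraction_unit_ball => z z1.
have hs : has_sup [set `|f x| | x in @unit_ball R V].
  apply: contrapT => /sup_out; rewrite -/(functional_norm f) f1.
  by move/eqP; rewrite oner_eq0.
apply: le_trans (ler_norm _) _; rewrite -f1.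
by apply: sup_upper_bound => //; exists z.
Qed.

Lemma BJ_contraction f x y :
  contraction f -> f x = `|x| -> f y = 0 -> BJ_orthogonal x y.
Proof.
move=> fC fx fy l; apply: le_trans _ (fC _).
by rewrite !scalE fy fx mulr0 addr0 normr_id.
Qed.

Lemma BJ_scale a b x y :
  BJ_orthogonal x y -> BJ_orthogonal (a *: x) (b *: y).
Proof.
move=> xy l; have [->|a0] := eqVneq a 0; first by rewrite scale0r normr0.
have -> : a *: x + l *: (b *: y) = a *: (x + (l * b / a) *: y).
  by rewrite scalerDr !scalerA mulrCA divff // mulr1.
by rewrite !normrZ ler_wpM2l // xy.
Qed.

Lemma contraction_norm1 f x : contraction f -> `|x| <= 1 -> f x = 1 -> `|x| = 1.
Proof.
move=> fC x1 fx; apply/eqP; rewrite eq_le x1 /=.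
by rewrite -(normr1 R) -fx.
Qed.

(** * Vertices, segments and edges *)

Lemma vertex_norm_le x : is_vertex x -> `|x| <= 1.
Proof. by case. Qed.

Lemma vertexN x : is_vertex x -> is_vertex (- x).
Proof.
move=> [x1 xE]; split; first by rewrite /unit_ball /= normrN.
move=> y z t y1 z1 t01 xyz; have [] := xE (- y) (- z) t.
- by rewrite /unit_ball /= normrN.
- by rewrite /unit_ball /= normrN.
- by [].
- by rewrite -(opprK x) xyz opprD !scalerN.
- by move=> yx zx; split; [rewrite -yx opprK|rewrite -zx opprK].
Qed.

Lemma segment_l u v : segment u v u.
Proof.
exists 0; first by rewrite /= in_itv /= lexx ler01.
by rewrite subr0 scale1r scale0r addr0.
Qed.

Lemma segment_r u v : segment u v v.
Proof.
exists 1; first by rewrite /= in_itv /= lexx ler01.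
by rewrite subrr scale0r scale1r add0r.
Qed.

Lemma segmentC u v : segment u v = segment v u.
Proof.
have sub a b : segment a b `<=` segment b a.
  move=> z [t /=]; rewrite in_itv /= => /andP[t0 t1] <-.
  exists (1 - t); last by rewrite subKr addrC.
  by rewrite /= in_itv /= subr_ge0 t1 lerBlDr lerDl.
by apply/seteqP; split; exact: sub.
Qed.


(** A contraction with value 1 at both ends has value 1 along the segment, which puts it on the
    sphere; a vertex strictly between [u] and [v] would contradict extremality. This is how all
    edges below are produced. *)
Lemma edge_contraction f u v : is_vertex u -> is_vertex v -> u <> v ->
  contraction f -> f u = 1 -> f v = 1 -> is_edge (segment u v).
Proof.
move=> uV vV uv fC fu fv; exists u, v; split => //.
  move=> z [t /=]; rewrite in_itv /= => /andP[t0 t1] <-.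
  apply: (contraction_norm1 fC); last by rewrite !scalE fu fv; ring.
  apply: le_trans (ler_normD _ _) _; rewrite !normrZ.
  rewrite ger0_norm ?subr_ge0 // ger0_norm //.
  have := vertex_norm_le uV; have := vertex_norm_le vV; nra.
move=> w [_ wE] [t /=]; rewrite in_itv /= => /andP[t0 t1] wt.
have [t00|tn0] := eqVneq t 0.
  by left; rewrite -wt t00 subr0 scale1r scale0r addr0.
have [t11|tn1] := eqVneq t 1.
  by right; rewrite -wt t11 subrr scale0r scale1r add0r.
have [|||-> _] := wE u v t _ _ _ (esym wt); last by left.
- exact: vertex_norm_le.
- exact: vertex_norm_le.
- by rewrite lt_neqAle eq_sym tn0 t0 lt_neqAle tn1 t1.
Qed.

Lemma translated_vertex_contraction f u v w : is_vertex w ->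
  contraction f -> `|u| <= 1 -> f u = 1 -> f v = 1 -> f w = 0 ->
  translated_vertex (segment u v) w.
Proof.
move=> wV fC u1 fu fv fw; split=> //; exists f; split=> //.
split; first exact: functional_norm_eq1 fC u1 fu.
by move=> _ [t _ <-]; rewrite !scalE fu fv; ring.
Qed.

Lemma edge_at_vertex (L : set V) x : is_edge L -> is_vertex x -> L x ->
  exists a, [/\ is_vertex a, a <> x, L = segment a x & L `<=` @unit_sphere R V].
Proof.
move=> [u [v [[uV vV] uv -> sph ends]]] xV Lx.
have [->|->] := ends x xV Lx; last by exists u.
by exists v; split => //; [move/esym|exact: segmentC].
Qed.

(** The line through a segment of the sphere supports the ball. Past the far end [b], the triangle
    inequality for [m *: b = (m - 1) *: a + (a + m *: (b - a))] gives the bound; exchanging the ends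
    covers the other half of the line. *)
Lemma norm_line_ge1 u v (l : R) : segment u v `<=` @unit_sphere R V ->
  1 <= `|u + l *: (v - u)|.
Proof.
have half a b (m : R) : 2^-1 <= m -> segment a b `<=` @unit_sphere R V ->
    1 <= `|a + m *: (b - a)|.
  move=> m2 sph; have [m1|m1] := leP m 1.
    rewrite (sph _ _) //; exists m; first by rewrite /= in_itv /=; lra.
    by rewrite scalerBr scalerBl scale1r addrA addrAC.
  have m0 : 0 < m by lra.
  have nb : `|b| = 1 by apply: sph; exact: segment_r.
  have na : `|a| = 1 by apply: sph; exact: segment_l.
  have mb : m *: b = (m - 1) *: a + (a + m *: (b - a)).
    by rewrite scalerBl scale1r addrA subrK scalerBr addrC subrK.
  have : `|m *: b| <= `|(m - 1) *: a| + `|a + m *: (b - a)|.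
    by rewrite mb ler_normD.
  by rewrite !normrZ na nb !mulr1 !ger0_norm; lra.
move=> sph; have [l2|l2] := leP 2^-1 l; first exact: half.
have -> : u + l *: (v - u) = v + (1 - l) *: (u - v).
  rewrite scalerBl scale1r addrA addrCA subrr addr0.
  by rewrite -scalerN opprB.
by apply: half; [lra|rewrite segmentC].
Qed.

End Functionals.
Arguments scalE {R V} f.

Lemma finite_argmin (R : realType) (T : choiceType) (A : set T) (phi : T -> R) :
  finite_set A -> A !=set0 ->
  exists2 b, A b & forall e, A e -> phi b <= phi e.
Proof.
move=> /finite_seqP[s ->] [a /= a_s].
have : s != [::] by case: s a_s.
elim: s {a a_s} => // a s IH _; have [->|/IH[b /= bs bmin]] := eqVneq s [::].
  exists a; first exact: mem_head.
  by move=> e /=; rewrite inE => /eqP ->.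
have [ab|ba] := leP (phi a) (phi b).
  exists a; first exact: mem_head.
  move=> e /=; rewrite inE => /orP[/eqP -> //|/bmin].
  exact: le_trans.
exists b; first by rewrite /= inE bs orbT.
move=> e /=; rewrite inE => /orP[/eqP ->|/bmin //].
exact: ltW.
Qed.

(** * Coordinates and dual bases in the plane *)

Section Plane.
Context (R : realType) (V : normedModType R) (V2 : two_dimensional V).
Implicit Types (f g h : {scalar V}) (x y z u v : V).

Lemma coordinates : exists p q : {scalar V},
  (forall u v, p u = p v -> q u = q v -> u = v) /\
  (forall s t, exists u, p u = s /\ q u = t).
Proof.
have [[phi phi_lin [psi phiK psiK]]] := V2.
have phiL i : scalar (fun u => phi u 0 i).
  by move=> c u v; rewrite phi_lin !mxE.
have [p pE] := scalar_ex (phiL 0); have [q qE] := scalar_ex (phiL 1).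
exists p, q; split=> [u v|s t].
  rewrite !pE !qE => puv quv; apply: (can_inj phiK); apply/rowP => i.
  have [->|->] // : i = 0 \/ i = 1.
  by case: i => [[|[|]]] // ?; [left|right]; apply: val_inj.
exists (psi (\row_i (if i == 0 then s else t))).
by rewrite pE qE psiK !mxE.
Qed.

(** Turns vector identities into scalar ones, within reach of [ring] and [field]. *)
Lemma vec_eq u v : (forall h : {scalar V}, h u = h v) -> u = v.
Proof.
by have [p [q [inj _]]] := coordinates => uv; apply: inj; exact: uv.
Qed.

Definition dual_basis x y f g :=
  [/\ f x = 1, f y = 0, g x = 0, g y = 1 & forall z, z = f z *: x + g z *: y].

Lemma dual_basis_ex x y : x != 0 -> (forall s, y <> s *: x) ->
  exists f g, dual_basis x y f g.
Proof.
move=> x0 yx; have [p [q [inj _]]] := coordinates.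
(* [w] is the determinant of [x], [y] in the coordinates [p], [q]; the functionals [f] and [g] below
   come from Cramer's rule. *)
set w := p x * q y - q x * p y.
have w0 : w != 0.
  apply/eqP => w0; have [px|px] := eqVneq (p x) 0.
    have qx : q x != 0.
      by apply: contra_neq x0 => qx; apply: inj; rewrite scalE.
    apply: (yx (q y / q x)); apply: inj; rewrite !scalE; last by field.
    apply: (mulfI qx); move: w0; rewrite /w px; lra.
  apply: (yx (p y / p x)); apply: inj; rewrite !scalE; first by field.
  apply: (mulfI px); rewrite mulrA mulrCA divff // mulr1; move: w0; rewrite /w; lra.
have [f fE] := scalar_comb p q (q y / w) (- p y / w).
have [g gE] := scalar_comb p q (- q x / w) (p x / w).
exists f, g; split; rewrite ?fE ?gE.
- by rewrite /w; field.
- by field.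
- by field.
- by rewrite /w; field.
- by move=> z; rewrite fE gE; apply: inj; rewrite !scalE /w; field.
Qed.

Lemma dual_basis_extend x : x != 0 -> exists y f g, dual_basis x y f g.
Proof.
move=> x0; have [p [q [inj sur]]] := coordinates.
have [y ny] : exists y, forall s, y <> s *: x.
  have [px|px] := eqVneq (p x) 0.
    have [y [py _]] := sur 1 0; exists y => s ys; move: py.
    by rewrite ys scalE px mulr0 => /esym/eqP; rewrite oner_eq0.
  have [y [py qy]] := sur 0 1; exists y => s ys; move: py qy.
  rewrite ys !scalE => /eqP; rewrite mulf_eq0 (negPf px) orbF => /eqP ->.
  by rewrite mul0r => /esym/eqP; rewrite oner_eq0.
by exists y; exact: dual_basis_ex.
Qed.

Lemma dual_basis_unique f' x y f g : dual_basis x y f g ->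
  f' x = 1 -> f' y = 0 -> f' =1 f.
Proof.
by move=> [_ _ _ _ zE] fx fy z; rewrite {1}(zE z) !scalE fx fy; ring.
Qed.

Lemma dual_basis_kernel f x : f x = 1 -> exists y g, dual_basis x y f g.
Proof.
move=> fx; have x0 : x != 0.
  by apply/eqP => x0; move: fx; rewrite x0 scalE => /esym/eqP; rewrite oner_eq0.
have [y [f' [g [fx' fy gx gy zE]]]] := dual_basis_extend x0.
(* Subtracting [f y *: x] moves the second basis vector into the kernel of [f]. *)
have [|f1 [g1 D]] := @dual_basis_ex x (y - f y *: x) x0.
  move=> s ys; have /eqP : g (y - f y *: x) = 1 by rewrite !scalE gx gy; ring.
  by rewrite ys scalE gx mulr0 eq_sym oner_eq0.
have fE : f =1 f1.
  by apply: (dual_basis_unique D) => //; rewrite !(scalE f) fx; ring.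
exists (y - f y *: x), g1; case: D => _ fy1 gx1 gy1 zE1.
by split=> // [|z]; rewrite fE.
Qed.

(** * Vertices and supporting lines in the plane *)

(** Of three distinct collinear points of the ball the middle one is not extreme. The middle one is
    [x] for [s < 0], [b] for [0 < s < 1] and [a] for [s > 1]. *)
Lemma vertex_collinear a b x (s : R) :
  is_vertex a -> is_vertex b -> is_vertex x -> a <> x -> b <> x ->
  b - x = s *: (a - x) -> a = b.
Proof.
move=> aV bV xV ax bx bE.
have bs : b = x + s *: (a - x) by rewrite -bE addrCA subrr addr0.
have [s0|s0|s0] := ltgtP s 0; last by case: bx; rewrite bs s0 scale0r addr0.
  have s1 : 1 - s != 0 by rewrite subr_eq0 gt_eqF // (lt_trans s0 ltr01).
  have [] := xV.2 a b (1 - s)^-1 (vertex_norm_le aV) (vertex_norm_le bV).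
  - by rewrite invr_gt0 invf_lt1; lra.
  - by apply: vec_eq => h; rewrite bs !scalE; field.
  - by move/ax.
have [s1|s1|s1] := ltgtP s 1; last by rewrite bs s1 scale1r addrCA subrr addr0.
  have [] := bV.2 x a s (vertex_norm_le xV) (vertex_norm_le aV).
  - by rewrite s0 s1.
  - by apply: vec_eq => h; rewrite bs !scalE; ring.
  - by move/esym/bx.
have sn0 : s != 0 by rewrite gt_eqF.
have [] := aV.2 x b s^-1 (vertex_norm_le xV) (vertex_norm_le bV).
- by rewrite invr_gt0 invf_lt1; lra.
- by apply: vec_eq => h; rewrite bs !scalE; field.
- by move/esym/ax.
Qed.

(** Converse of [BJ_contraction], with no need of Hahn-Banach: the coordinate along [x] with kernel
    spanned by [y] is a contraction, because [z = f z *: (x + l *: y)] has norm at least that of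
    [f z *: x]. *)
Lemma BJ_dual x y : `|x| = 1 -> y != 0 -> BJ_orthogonal x y ->
  exists f g, dual_basis x y f g /\ contraction f.
Proof.
move=> x1 y0 xy; have x0 : x != 0 by rewrite -normr_eq0 x1 oner_eq0.
have [s ys|f [g D]] := @dual_basis_ex x y x0.
  have s0 : s != 0 by apply: contra_neq y0 => s0; rewrite ys s0 scale0r.
  have := xy (- s^-1); rewrite ys scalerA mulNr mulVf // scaleN1r subrr normr0 x1.
  by rewrite ler10.
exists f, g; split => // z; have [fx fy gx gy zE] := D.
have [->|fz] := eqVneq (f z) 0; first by rewrite normr0.
have -> : z = f z *: (x + (g z / f z) *: y).
  by apply: vec_eq => h; rewrite {1}(zE z) !scalE; field.
rewrite normrZ !scalE fx fy mulr0 addr0 mulr1.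
by rewrite ler_peMr // -x1 xy.
Qed.

(** A segment of the ball with [v] in its interior lies in both supporting lines [f = 1] and
    [g = 1], which meet only at [v]. *)
Lemma vertex_of_contractions f g v : contraction f -> contraction g ->
  `|v| <= 1 -> f v = 1 -> g v = 1 ->
  (forall z, f z = 0 -> g z = 0 -> z = 0) -> is_vertex v.
Proof.
move=> fC gC v1 fv gv fg; split => // y z t y1 z1 /andP[t0 t1] vE.
have face k : contraction k -> k v = 1 -> k y = 1 /\ k z = 1.
  move=> kC kv; have := kv; rewrite vE !scalE.
  have := le_trans (ler_norm _) (le_trans (kC y) y1).
  have := le_trans (ler_norm _) (le_trans (kC z) z1).
  by move=> *; split; nra.
have [[fy fz] [gy gz]] := (face f fC fv, face g gC gv).
by split; apply/eqP; rewrite -subr_eq0; apply/eqP; apply: fg;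
   rewrite !scalE ?fy ?fz ?gy ?gz ?fv ?gv subrr.
Qed.

(* The nearest point of the line [h = 1] to the origin spans a maximizer of [h]
   on the ball; the far end of the set of such points is extreme. This avoids
   compactness of the ball in two dimensions. *)
Lemma vertex_max h x : h x = 1 ->
  exists2 e, is_vertex e & forall z, `|z| <= 1 -> h z <= h e.
Proof.
move=> hx; have [y [g [_ hy gx gy zE]]] := dual_basis_kernel hx.
have y0 : 0 < `|y|.
  rewrite normr_gt0; apply/eqP => y0; move: gy.
  by rewrite y0 scalE => /esym/eqP; rewrite oner_eq0.
pose phi (t : R) : R := `|x + t *: y|.
have phi_lip s t : phi s <= phi t + `|s - t| * `|y|.
  rewrite -normrZ; apply: le_trans _ (ler_normD _ _).
  by rewrite -addrA -scalerDl [t + _]addrC subrK.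
have phi0 : phi 0 = `|x| by rewrite /phi scale0r addr0.
have phi_cont : continuous phi.
  move=> t; apply: (@continuous_comp _ _ _ (fun s : R => x + s *: y) Num.norm).
    by apply: cvgD; [exact: cvg_cst|apply: cvgZr_tmp; exact: cvg_id].
  exact: norm_continuous.
(* Outside [[- M, M]] the value of [phi] exceeds [phi 0], so a minimum over this interval is
   global. *)
pose M := 2 * `|x| / `|y|.
have phi_big t : phi t <= `|x| -> `|t| <= M.
  move=> phit; rewrite ler_pdivlMr // -normrZ.
  have -> : t *: y = (x + t *: y) - x by rewrite addrAC subrr add0r.
  by apply: le_trans (ler_normB _ _) _; rewrite -/(phi t); lra.
have M0 : 0 <= M by rewrite divr_ge0 // mulr_ge0.
have [|t0 t0M t0min] := @EVT_min R phi (- M) M _ (continuous_subspaceT phi_cont).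
  by rewrite ge0_cp.
pose d := phi t0.
have d_min t : d <= phi t.
  have [tM|tM] := leP `|t| M.
    by apply: t0min; rewrite in_itv /= -ler_norml.
  apply: (@le_trans _ _ (phi 0)).
    by apply: t0min; rewrite in_itv /= -ler_norml normr0.
  by rewrite phi0 leNgt; apply/negP => /ltW /phi_big; rewrite leNgt tM.
have d0 : 0 < d.
  rewrite normr_gt0; apply/eqP => /(congr1 h); rewrite !(scalE h) hx hy mulr0.
  by move/eqP; rewrite addr0 oner_eq0.
have h_le z : `|z| <= 1 -> h z <= d^-1.
  move=> z1; rewrite -[d^-1]mul1r ler_pdivlMr //; have [hz|hz] := leP (h z) 0.
    by apply: le_trans ler01; rewrite mulr_le0_ge0 // ltW.
  apply: le_trans z1; rewrite {2}(zE z).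
  have -> : h z *: x + g z *: y = h z *: (x + (g z / h z) *: y).
    by rewrite scalerDr scalerA mulrCA divff ?mulr1 // gt_eqF.
  by rewrite normrZ gtr0_norm // ler_pM2l // d_min.
pose S := [set t | phi t <= d].
have St0 : S t0 by rewrite /S /= lexx.
have d_x : d <= `|x| by rewrite -phi0 d_min.
have supS : has_sup S.
  split; first by exists t0.
  exists M => t St; apply: le_trans (ler_norm t) _.
  by apply: phi_big; exact: le_trans St d_x.
(* The last minimizer of [phi]; the Lipschitz bound [phi_lip] shows that the supremum is
   attained. *)
pose t2 := sup S.
have St2 : phi t2 <= d.
  apply/ler_addgt0Pr => e e0.
  have [t St t2t] := sup_adherent (divr_gt0 e0 y0) supS.
  apply: le_trans (phi_lip t2 t) _; apply: lerD => //.
  rewrite -ler_pdivlMr // ger0_norm.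
    by rewrite lerBlDr addrC -lerBlDr ltW.
  by rewrite subr_ge0; exact: sup_upper_bound.
pose e := d^-1 *: (x + t2 *: y).
have he : h e = d^-1 by rewrite !(scalE h) hx hy mulr0 addr0 mulr1.
have ge : g e = d^-1 * t2 by rewrite !(scalE g) gx gy mulr1 add0r.
exists e; last by rewrite he.
split.
  by rewrite /unit_ball /= normrZ gtr0_norm ?invr_gt0 // mulrC ler_pdivrMr // mul1r.
(* Both ends of a segment through [e] must maximize [h] on the ball; among such maximizers [g] is
   largest at [e], since [t2] is a supremum. Hence both coordinates agree with those of [e]. *)
move=> u v t u1 v1 /andP[t_gt0 t_lt1] eE.
have := h_le u u1; have := h_le v v1; rewrite -he => hv hu.
have he' : h e = (1 - t) * h u + t * h v by rewrite eE !(scalE h).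
have hue : h u = h e by nra.
have hve : h v = h e by nra.
have g_le w : `|w| <= 1 -> h w = h e -> g w <= g e.
  move=> w1 hw; rewrite ge -ler_pdivrMl ?invr_gt0 // invrK.
  apply: sup_upper_bound => //; rewrite /S /= /phi.
  have -> : x + (d * g w) *: y = d *: w.
    by rewrite {2}(zE w) hw he scalerDr !scalerA divff ?gt_eqF // scale1r.
  by rewrite normrZ gtr0_norm // ger_pMr.
have := g_le u u1 hue; have := g_le v v1 hve => gv gu.
have ge' : g e = (1 - t) * g u + t * g v by rewrite {1}eE !(scalE g).
have gue : g u = g e by nra.
have gve : g v = g e by nra.
by split; [rewrite (zE u) hue gue -zE|rewrite (zE v) hve gve -zE].
Qed.

(* Rotate the supporting line [f = 1] as far as possible in the direction [g]:
   it stops at a vertex on the side [g > 0]. *)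
Lemma side_vertex f g y : polygonal V -> contraction f -> g y = 1 ->
  exists (c : R) (b : V) (F : {scalar V}), [/\ 0 <= c, is_vertex b, 0 < g b, F b = 1 &
    contraction F /\ forall z, F z = f z + c * g z].
Proof.
move=> Vpoly fC gy.
have [e0 e0V e0max] := vertex_max gy.
have ge0 : 0 < g e0.
  have y0 : 0 < `|y|.
    rewrite normr_gt0; apply/eqP => y0; move: gy.
    by rewrite y0 scalE => /esym/eqP; rewrite oner_eq0.
  apply: lt_le_trans (e0max (`|y|^-1 *: y) _).
    by rewrite (scalE g) gy mulr1 invr_gt0.
  by rewrite normrZ normfV normr_id mulVf // gt_eqF.
(* The least ratio [(1 - f e) / g e] is the largest [c] for which [f + c * g] stays at most 1 at
   every vertex with [g > 0]. *)
have [||b [bV gb] bmin] := @finite_argmin R V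
    [set e | is_vertex e /\ 0 < g e] (fun e => (1 - f e) / g e).
- by apply: sub_finite_set Vpoly => e [].
- by exists e0.
have f1 e : is_vertex e -> f e <= 1.
  by move=> [e1 _]; apply: le_trans (ler_norm _) (le_trans (fC e) e1).
pose c := (1 - f b) / g b.
have c0 : 0 <= c by rewrite divr_ge0 ?subr_ge0 ?f1 // ltW.
have [F FE0] := scalar_comb f g 1 c.
have FE z : F z = f z + c * g z by rewrite FE0 mul1r.
have Fb : F b = 1 by rewrite FE /c divfK ?gt_eqF // addrC subrK.
exists c, b, F; split=> //; split=> //; apply: contraction_unit_ball => z z1.
(* [F] attains its maximum over the ball at a vertex, so only vertices need checking. *)
have [e eV emax] := vertex_max Fb; apply: le_trans (emax z z1) _; rewrite FE.
have [g_le0|g_gt0] := leP (g e) 0.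
  by have := f1 e eV; nra.
have : c <= (1 - f e) / g e by exact: bmin.
by rewrite ler_pdivlMr //; lra.
Qed.

(** * The Radon property implies TEP *)

Lemma radon_translated_vertex a x : radon_plane V ->
  is_vertex a -> is_vertex x -> a <> x -> segment a x `<=` @unit_sphere R V ->
  exists v r, [/\ translated_vertex (segment a x) v, v = r *: (a - x), `|v| = 1,
    BJ_orthogonal x v & BJ_orthogonal v x].
Proof.
move=> radon aV xV ax sph.
have a1 : `|a| = 1 := sph a (segment_l a x).
have x1 : `|x| = 1 := sph x (segment_r a x).
have d0 : a - x != 0 by rewrite subr_eq0; apply/eqP.
pose r := `|a - x|^-1; pose v := r *: (a - x).
have v1 : `|v| = 1 by rewrite normrZ normfV normr_id mulVf // normr_eq0.
have v0 : v != 0 by rewrite -normr_eq0 v1 oner_eq0.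
have xd : BJ_orthogonal x (a - x).
  by move=> l; rewrite x1; apply: norm_line_ge1; rewrite segmentC.
have ad : BJ_orthogonal a (x - a).
  by move=> l; rewrite a1; exact: norm_line_ge1.
have xv : BJ_orthogonal x v by have := BJ_scale 1 r xd; rewrite scale1r.
have av : BJ_orthogonal a v.
  have := BJ_scale 1 (- r) ad; rewrite scale1r scaleNr -scalerN opprB.
  by rewrite -/v.
have vx := radon _ _ xv; have va := radon _ _ av.
have a0 : a != 0 by rewrite -normr_eq0 a1 oner_eq0.
have x0 : x != 0 by rewrite -normr_eq0 x1 oner_eq0.
have [f1 [g1 [D1 f1C]]] := BJ_dual v1 x0 vx.
have [f2 [g2 [[f2v f2a _ _ _] f2C]]] := BJ_dual v1 a0 va.
have [f1v f1x _ _ zE] := D1.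
have vV : is_vertex v.
  apply: (vertex_of_contractions f1C f2C) => //; first by rewrite v1.
  move=> z f1z f2z; have zx : z = g1 z *: x by rewrite {1}(zE z) f1z scale0r add0r.
  (* The supporting lines given by [f1] and [f2] differ: if [f2] vanished at [x] as well as at [a],
     it would vanish at [v], where it is 1. *)
  have f2x : f2 x != 0.
    apply/eqP => f2x; have := f2v.
    by rewrite !(scalE f2) f2x f2a subrr mulr0 => /esym/eqP; rewrite oner_eq0.
  move: f2z; rewrite zx (scalE f2) => /eqP; rewrite mulf_eq0 (negPf f2x) orbF.
  by move=> /eqP ->; rewrite scale0r.
exists v, r; split=> //.
have [f [g [[fx fd _ _ _] fC]]] := BJ_dual x1 d0 xd.
apply: (translated_vertex_contraction vV fC); rewrite ?a1 //.
  by move: fd; rewrite !(scalE f) fx => /eqP; rewrite subr_eq0 => /eqP.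
by rewrite (scalE f) fd mulr0.
Qed.

Lemma radon_TEP : radon_plane V -> satisfies_TEP V.
Proof.
move=> radon L M x [LE ME LM xV [Lx Mx]].
have [a [aV ax La Lsph]] := edge_at_vertex LE xV Lx.
have [b [bV bx Mb Msph]] := edge_at_vertex ME xV Mx.
rewrite La in Lsph LM *; rewrite Mb in Msph LM *; clear L M La Mb LE ME Lx Mx.
have [v [r [vT vE v1 xv vx]]] := radon_translated_vertex radon aV xV ax Lsph.
have [w [s [wT wE w1 xw wx]]] := radon_translated_vertex radon bV xV bx Msph.
have x1 : `|x| = 1 := Lsph x (segment_r a x).
have x0 : x != 0 by rewrite -normr_eq0 x1 oner_eq0.
have s0 : s != 0.
  apply/eqP => s0; have /eqP := w1.
  by rewrite wE s0 scale0r normr0 eq_sym oner_eq0.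
(* If [v] and [w] were parallel, [a], [b], [x] would be collinear vertices, and the two edges would
   coincide. *)
have vw c : w <> c *: v.
  move=> wv; apply: LM; congr segment.
  apply: (@vertex_collinear a b x (s^-1 * (c * r))) => //.
  by rewrite -!scalerA -vE -wv wE scalerA mulVf // scale1r.
have [k [k' [D kC]]] := BJ_dual v1 x0 vx.
have [kv kx _ _ _] := D.
have [l [l' [[lw lx _ _ _] lC]]] := BJ_dual w1 x0 wx.
(* [l] and [k] have the same kernel, and each is at most 1 where the other is 1. *)
have lE : l w = k w * l v.
  by case: D => _ _ _ _ zE; rewrite {1}(zE w) !(scalE l) lx mulr0 addr0.
have kw : k w = 1 \/ k w = - 1.
  have := kC w; have := lC v; rewrite v1 w1 => lv1 kw1.
  have := normrM (k w) (l v); rewrite -lE lw normr1 => kl.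
  have kw_eq1 : `|k w| = 1 by have := normr_ge0 (k w); nra.
  by have [_|_] := leP 0 (k w); move: kw_eq1; case: ler0P => _; lra.
have [vV wV] := (vT.1, wT.1).
exists v, w; split=> //; case: kw => kw; [left|right]; split.
- apply: (edge_contraction vV wV _ kC) => // vwE.
  by apply: (vw 1); rewrite scale1r.
- by apply: (translated_vertex_contraction xV kC) => //; rewrite v1.
- have kw' : k (- w) = 1 by rewrite (scalE k) kw opprK.
  apply: (edge_contraction vV (vertexN wV) _ kC) => // vwE.
  by apply: (vw (-1)); rewrite vwE scaleN1r opprK.
- have kw' : k (- w) = 1 by rewrite (scalE k) kw opprK.
  by apply: (translated_vertex_contraction xV kC) => //; rewrite v1.
Qed.

(** * TEP implies the Radon property *)

(** Replacing [w] by its negative where necessary merges the two alternatives of TEP. *)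
Lemma TEP_pair_contraction (L M : set V) x : TEP_pair L M x ->
  exists v w (f g k : {scalar V}), [/\ is_vertex v /\ is_vertex w,
    f v = 0 /\ (forall z, L z -> f z = 1),
    g w = 0 /\ (forall z, M z -> g z = 1),
    contraction k & [/\ k v = 1, k w = 1 & k x = 0]].
Proof.
move=> [v [w [[vV [f [[_ fL] fv]]] [wV [g [[_ gM] gw]]] vwx]]].
have {wV gw vwx} [w' [w'V gw' [_ [k [[k1 kvw] kx]]]]] :
    exists w', [/\ is_vertex w', g w' = 0 & translated_vertex (segment v w') x].
  case: vwx => [[_ T]|[_ T]]; first by exists w.
  by exists (- w); split=> //; [exact: vertexN|rewrite (scalE g) gw oppr0].
exists v, w', f, g, k; split=> //; first exact: functional_norm1_contraction.
by split=> //; apply: kvw; [exact: segment_l|exact: segment_r].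
Qed.

(** Rotating [f = 1] about [b], away from [a], yields the adjacent edge. TEP at [b] then makes the
    vertex [v] parallel to [b - a] and supplies a functional supporting at [v] and vanishing at
    [b]. *)
Lemma TEP_edge_end a b f : polygonal V -> satisfies_TEP V ->
  is_vertex a -> is_vertex b -> a <> b -> contraction f -> f a = 1 -> f b = 1 ->
  BJ_orthogonal (b - a) b.
Proof.
move=> Vpoly tep aV bV ab fC fa fb.
have b0 : b != 0.
  by apply/eqP => b0; move: fb; rewrite b0 scalE => /esym/eqP; rewrite oner_eq0.
have fba : f (b - a) = 0 by rewrite !(scalE f) fa fb subrr.
have [s bas|f' [g D]] := @dual_basis_ex b (b - a) b0.
  move: fba; rewrite bas (scalE f) fb mulr1 => s0.
  by move: bas; rewrite s0 scale0r => /eqP; rewrite subr_eq0 => /eqP/esym.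
have [_ _ gb gba zE] := D; have fE := dual_basis_unique D fb fba.
have ga : g a = -1 by move: gba; rewrite !(scalE g) gb; lra.
have [c [d [F [c0 dV gd Fd [FC FE]]]]] := side_vertex Vpoly fC gba.
have Fb : F b = 1 by rewrite FE gb mulr0 addr0.
have abE := edge_contraction aV bV ab fC fa fb.
have bd : b <> d by move=> bd; move: gd; rewrite -bd gb ltxx.
have bdE := edge_contraction bV dV bd FC Fb Fd.
have /tep/TEP_pair_contraction :
    adjacent_at (segment a b) (segment b d) b.
  split=> //; last by split; [exact: segment_r|exact: segment_l].
  move=> LM; have : segment b d a by rewrite -LM; exact: segment_l.
  move=> [t /=]; rewrite in_itv /= => /andP[t0 t1] /(congr1 g).
  by rewrite !(scalE g) gb ga; nra.
move=> [v [w [fL [gM [k [[vV wV] [fLv fL1] _ kC [kv kw kb]]]]]]].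
have fLa := fL1 a (segment_l a b); have fLb := fL1 b (segment_r a b).
have fLE : fL =1 f'.
  by apply: (dual_basis_unique D) => //; rewrite !(scalE fL) fLa fLb subrr.
have v1 := contraction_norm1 kC (vertex_norm_le vV) kv.
have vE : v = g v *: (b - a) by rewrite {1}(zE v) -fLE fLv scale0r add0r.
have gv0 : g v != 0.
  by apply/eqP => gv; move: v1; rewrite vE gv scale0r normr0 => /esym/eqP;
     rewrite oner_eq0.
have vb : BJ_orthogonal v b by apply: (BJ_contraction kC) => //; rewrite v1.
have := BJ_scale (g v)^-1 1 vb; rewrite scale1r.
by rewrite {2}vE scalerA mulVf // scale1r.
Qed.

(* [fun u => g u - g z * f u] vanishes at [z] and equals 1 at [y]. *)
Lemma BJ_dual_basis_iff x y z f g : dual_basis x y f g -> f z = 1 ->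
  BJ_orthogonal y z <-> forall u, `|g u - g z * f u| * `|y| <= `|u|.
Proof.
move=> [_ fy _ gy zE] fz; split=> [yz u|yz l].
  set k := g u - g z * f u; have [k0|k0] := eqVneq k 0; first by rewrite k0 normr0 mul0r.
  have -> : u = k *: (y + (f u / k) *: z).
    rewrite {1}(zE u) {1}(zE z) fz scale1r !scalerDr !scalerA.
    rewrite [k * _]mulrCA divff // mulr1 addrCA -scalerDl.
    by congr (_ + _ *: _); rewrite /k; ring.
  by rewrite normrZ ler_wpM2l.
apply: le_trans _ (yz _); rewrite !(scalE f) !(scalE g) fy gy fz.
by rewrite add0r mulr1 [g z * l]mulrC addrK normr1 mul1r.
Qed.

Lemma TEP_BJ_sym_unit x y : polygonal V -> satisfies_TEP V ->
  `|x| = 1 -> y != 0 -> BJ_orthogonal x y -> BJ_orthogonal y x.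
Proof.
move=> Vpoly tep x1 y0 xy.
have [f [g [D fC]]] := BJ_dual x1 y0 xy; have [fx fy gx gy zE] := D.
have [c1 [b [F1 [c1_ge0 bV gb F1b [F1C F1E]]]]] := side_vertex Vpoly fC gy.
have [g' g'E] := scalar_comb g g (-1) 0.
have g'y : g' (- y) = 1 by rewrite g'E !(scalE g) gy; ring.
have [c2 [a [F2 [c2_ge0 aV g'a F2a [F2C F2E']]]]] := side_vertex Vpoly fC g'y.
have ga : g a < 0 by move: g'a; rewrite g'E; lra.
have F2E z : F2 z = f z - c2 * g z by rewrite F2E' g'E; ring.
have F1x : F1 x = 1 by rewrite F1E fx gx mulr0 addr0.
have F2x : F2 x = 1 by rewrite F2E fx gx mulr0 subr0.
have ab : a <> b by move=> ab; move: ga; rewrite ab; lra.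
have ax : a <> x by move=> ax; move: ga; rewrite ax gx ltxx.
have xb : x <> b by move=> xb; move: gb; rewrite -xb gx ltxx.
(* Both amounts are nonnegative, so a zero sum means that neither rotation moves the line: [a] and
   [b] lie on [f = 1], with [x] between them. *)
have [c0|c0] := eqVneq (c1 + c2) 0.
  have fa : f a = 1 by move: F2a; rewrite F2E; nra.
  have fb : f b = 1 by move: F1b; rewrite F1E; nra.
  have r0 : g b - g a != 0 by rewrite gt_eqF //; lra.
  have baE : b - a = (g b - g a) *: y.
    by rewrite [LHS]zE !(scalE f) !(scalE g) fa fb subrr scale0r add0r.
  have yb : BJ_orthogonal y b.
    have := BJ_scale (g b - g a)^-1 1 (TEP_edge_end Vpoly tep aV bV ab fC fa fb).
    by rewrite baE scalerA mulVf // !scale1r.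
  have ya : BJ_orthogonal y a.
    have := BJ_scale (g a - g b)^-1 1
      (TEP_edge_end Vpoly tep bV aV (nesym ab) fC fb fa).
    rewrite -[a - b]opprB baE -scaleNr opprB scalerA mulVf ?scale1r //.
    by rewrite -opprB oppr_eq0.
  (* The quantity [g u - g z * f u] is affine in [g z], so the bounds at [a] and [b] combine, with
     weights [g b] and [- g a], into the bound at [x], where [g x = 0]. *)
  move/(BJ_dual_basis_iff D fb): yb => yb.
  move/(BJ_dual_basis_iff D fa): ya => ya.
  apply/(BJ_dual_basis_iff D fx) => u; rewrite gx mul0r subr0.
  have gbu : (g b - g a) * g u
      = g b * (g u - g a * f u) + - g a * (g u - g b * f u) by ring.
  have gu_le : (g b - g a) * `|g u|
      <= g b * `|g u - g a * f u| + - g a * `|g u - g b * f u|.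
    have rE : `|g b - g a| = g b - g a by rewrite ger0_norm //; lra.
    rewrite -{1}rE -normrM gbu; apply: le_trans (ler_normD _ _) _.
    by rewrite !normrM (gtr0_norm gb) normrN (ltr0_norm ga).
  have r_gt0 : 0 < g b - g a by lra.
  rewrite -(ler_pM2l r_gt0) mulrA.
  apply: le_trans (ler_wpM2r (normr_ge0 y) gu_le) _.
  by have := yb u; have := ya u; nra.
have xV : is_vertex x.
  apply: (vertex_of_contractions F1C F2C) => //; first by rewrite x1.
  move=> z; rewrite F1E F2E => z1 z2.
  have gz : g z = 0 by apply: (mulfI c0); lra.
  have fz : f z = 0 by move: z1; rewrite gz; lra.
  by rewrite (zE z) fz gz !scale0r addr0.
have axE := edge_contraction aV xV ax F2C F2a F2x.
have xbE := edge_contraction xV bV xb F1C F1x F1b.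
have /tep/TEP_pair_contraction : adjacent_at (segment a x) (segment x b) x.
  split=> //; last by split; [exact: segment_r|exact: segment_l].
  move=> LM; have : segment x b a by rewrite -LM; exact: segment_l.
  move=> [t /=]; rewrite in_itv /= => /andP[t0 t1] /(congr1 g).
  by rewrite !(scalE g) gx; nra.
move=> [v [w [fL [gM [k [[vV wV] [fLv fL1] [gMw gM1] kC [kv kw kx]]]]]]].
have coordE (l : {scalar V}) z : l z = f z * l x + g z * l y.
  by rewrite {1}(zE z) !(scalE l).
(* [fL] agrees with [F2], that is [f - c2 * g], at [x] and [a], and it vanishes at [v]. Likewise
   [gM] is [f + c1 * g] and vanishes at [w]. *)
have fv : f v = c2 * g v.
  have := fL1 x (segment_r a x); have := fL1 a (segment_l a x).
  move: fLv F2a; rewrite (coordE fL v) (coordE fL a) F2E => fLv F2a fLa fLx.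
  have fLy : fL y = - c2.
    have ga0 : g a != 0 by rewrite lt_eqF.
    by apply: (mulfI ga0); move: fLa F2a; rewrite fLx; lra.
  by move: fLv; rewrite fLx fLy; lra.
have fw : f w = - c1 * g w.
  have := gM1 x (segment_l x b); have := gM1 b (segment_r x b).
  move: gMw F1b; rewrite (coordE gM w) (coordE gM b) F1E => gMw F1b gMb gMx.
  have gMy : gM y = c1.
    have gb0 : g b != 0 by rewrite gt_eqF.
    by apply: (mulfI gb0); move: gMb F1b; rewrite gMx; lra.
  by move: gMw; rewrite gMx gMy; lra.
have kgv : g v * k y = 1 by rewrite -kv (coordE k v) kx mulr0 add0r.
have kgw : g w * k y = 1 by rewrite -kw (coordE k w) kx mulr0 add0r.
(* The direction [y] lies in the cone over the edge [v w] parallel to [x]. *)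
have yE : (c1 + c2) *: y = k y *: (c1 *: v + c2 *: w).
  apply: vec_eq => l; rewrite !(scalE l) (coordE l v) (coordE l w) fv fw.
  have -> : k y * (c1 * (c2 * g v * l x + g v * l y)
      + c2 * (- c1 * g w * l x + g w * l y))
    = c1 * c2 * l x * (g v * k y - g w * k y)
      + (c1 * (g v * k y) + c2 * (g w * k y)) * l y by ring.
  by rewrite kgv kgw; ring.
(* By [yE], [y] is [k y] times a weighted mean of [v] and [w], both in the ball. As [k] vanishes at
   [x], it bounds the norm of [y + l *: x] below by that of [y]. *)
have y_le : `|y| <= `|k y|.
  have c_gt0 : 0 < c1 + c2 by rewrite lt_neqAle eq_sym c0 addr_ge0.
  rewrite -(ler_pM2l c_gt0) -{1}(gtr0_norm c_gt0) -normrZ yE normrZ mulrC.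
  rewrite ler_wpM2r //; apply: le_trans (ler_normD _ _) _; rewrite !normrZ.
  rewrite !ger0_norm //.
  by have := vertex_norm_le vV; have := vertex_norm_le wV; nra.
move=> l; apply: le_trans y_le _; apply: le_trans _ (kC _).
by rewrite !(scalE k) kx mulr0 addr0.
Qed.

Lemma TEP_radon : polygonal V -> satisfies_TEP V -> radon_plane V.
Proof.
move=> Vpoly tep x y xy.
have [->|x0] := eqVneq x 0; first by move=> l; rewrite scaler0 addr0.
have [->|y0] := eqVneq y 0; first by move=> l; rewrite normr0.
have nx : `|x| != 0 by rewrite normr_eq0.
have /(TEP_BJ_sym_unit Vpoly tep _ y0) : BJ_orthogonal (`|x|^-1 *: x) y.
  by have := BJ_scale `|x|^-1 1 xy; rewrite scale1r.
rewrite normrZ normfV normr_id mulVf // => /(_ erefl) /(BJ_scale 1 `|x|).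
by rewrite scale1r scalerA divff // scale1r.
Qed.

End Plane.

Theorem theorem2p6 (R : realType) (X : completeNormedModType R)
    (X_dim2 : two_dimensional X) (X_polygonal : polygonal X) :
  radon_plane X <-> satisfies_TEP X.
Proof.
by split; [exact: radon_TEP|exact: TEP_radon].
Qed.
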